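(* Let $N\ge2$, let $J_1,J_2$ be the two Poisson tensors of the Toda lattice in natural coordinates $(q_1,\dots,q_N,p_1,\dots,p_N)$ on $\mathbb{R}^{2N}$, let $\mathcal{R}=J_2J_1^{-1}$ be the recursion operator, let $J_j=\mathcal{R}^{j-1}J_1$ for $j\ge1$, and let $Y_j=D(J_j)$ be the modular vector field of $J_j$. Then for every integer $j\ge2$, $$Y_{j+1}=j\,\mathcal{R}^{j-1}\,Y_2.$$
   Context: Coordinates: $(x_1,\dots,x_{2N})=(q_1,\dots,q_N,p_1,\dots,p_N)$. A Poisson tensor $J$ is identified with its matrix $J_{ik}=\{x_i,x_k\}_J$; vector fields are identified with column vectors of components, on which the matrix $\mathcal{R}$ acts by multiplication. The modular vector field (with respect to the standard volume) of $J$ is $$D(J)=\sum_{k}\Big(\sum_{i}\frac{\partial J_{ki}}{\partial x_i}\Big)\frac{\partial}{\partial x_k}.$$ In particular $Y_2=-2\sum_{i=1}^N\frac{\partial}{\partial q_i}=(-2,\dots,-2,0,\dots,0)^t$. The tensors are $J_1=4\hat J_1$, $J_2=2\hat J_2$ with $$\hat J_1=\begin{pmatrix}0&I_N\\-I_N&0\end{pmatrix},\qquad \hat J_2=\begin{pmatrix}A_N&B_N\\-B_N&C_N\end{pmatrix},$$ where $I_N$ is the $N\times N$ identity matrix, $A_N$ is the skew-symmetric matrix with entries $1$ for $i<j$ and $-1$ for $i>j$, $B_N=\operatorname{diag}(-p_1,\dots,-p_N)$, and $C_N$ is the skew-symmetric matrix whose only nonzero entries are $c_{i,i+1}=-c_{i+1,i}=e^{q_i-q_{i+1}}$,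 $1\le i\le N-1$. *)

(* Defs.v *)
From mathcomp Require Import all_boot all_order all_algebra.
From mathcomp Require Import all_classical all_reals all_analysis.

Set Implicit Arguments.
Unset Strict Implicit.
Unset Printing Implicit Defensive.

Import Order.TTheory GRing.Theory Num.Theory.
Import numFieldNormedType.Exports.

Local Open Scope ring_scope.

(* Points of R^n are row vectors and vector fields take values in column
   vectors, on which matrices act from the left. *)

Definition partial (R : realType) (n : nat) (i : 'I_n) (f : 'rV[R]_n -> R)
    (x : 'rV[R]_n) : R :=
  'D_(delta_mx 0 i) f x.

(* Modular vector field, for the standard volume of R^n, of the bivector field
   whose matrix is J. *)
Definition modular_field (R : realType) (n : nat) (J : 'rV[R]_n -> 'M[R]_n)
    (x : 'rV[R]_n) : 'cV[R]_n :=
  \col_k \sum_(i < n) partial i (fun y => J y k i) x.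

Section Toda.
Variables (R : realType) (N : nat).
Implicit Type x : 'rV[R]_(N + N).

(* x = (q_1, ..., q_N, p_1, ..., p_N), with indices shifted to start at 0. *)
Definition q x (i : 'I_N) : R := x 0 (lshift N i).
Definition p x (i : 'I_N) : R := x 0 (rshift N i).

Definition A_mx : 'M[R]_N :=
  \matrix_(i, j) (if (i < j)%N then 1 else if (j < i)%N then -1 else 0).

Definition B_mx x : 'M[R]_N := diag_mx (\row_i - p x i).

Definition C_mx x : 'M[R]_N :=
  \matrix_(i, j) (if j == i.+1 :> nat then expR (q x i - q x j)
                  else if i == j.+1 :> nat then - expR (q x j - q x i)
                  else 0).

Definition J1hat : 'M[R]_(N + N) := block_mx 0 1%:M (- 1%:M) 0.

Definition J2hat x : 'M[R]_(N + N) :=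
  block_mx A_mx (B_mx x) (- B_mx x) (C_mx x).

Definition J1 x : 'M[R]_(N + N) := 4 *: J1hat.

Definition J2 x : 'M[R]_(N + N) := 2 *: J2hat x.

Definition recursion_op x : 'M[R]_(N + N) := J2 x *m invmx (J1 x).

(* Only meaningful for j >= 1; toda_tensor1 and toda_tensor2 below check that
   the hierarchy starts with J1 and J2. *)
Definition toda_tensor (j : nat) x : 'M[R]_(N + N) :=
  recursion_op x ^+ j.-1 *m J1 x.

Definition toda_modular (j : nat) : 'rV[R]_(N + N) -> 'cV[R]_(N + N) :=
  modular_field (toda_tensor j).

Lemma J1_unit x : J1 x \in unitmx.
Proof.
rewrite unitmxZ ?unitfE ?pnatr_eq0//.
suff: J1hat *m (- J1hat) = 1%:M by case/mulmx1_unit.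
by rewrite mulmxN mulmx_block !(mul0mx, mulmx0, mul1mx, mulmx1, add0r, addr0)
  opp_block_mx !oppr0 opprK -scalar_mx_block.
Qed.

Lemma toda_tensor1 : toda_tensor 1 = J1.
Proof. by apply/funext => x; rewrite /toda_tensor expr0 mul1mx. Qed.

Lemma toda_tensor2 : toda_tensor 2 = J2.
Proof.
by apply/funext => x; rewrite /toda_tensor expr1 mulmxKV// J1_unit.
Qed.

End Toda.

(* Main.v *)
Require Import Defs.
From mathcomp Require Import all_boot all_order all_algebra.
From mathcomp Require Import all_classical all_reals all_analysis.
From mathcomp Require Import zify ring lra.

Import GRing.Theory Num.Theory.
Import numFieldNormedType.Exports.
Local Open Scope ring_scope.

(** Write r for the recursion operator, P for the constant tensor J_1, and D for
    the modular field.  For a skew-symmetric matrix S let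
      v(S)_k = sum over i and b of (d r_(k,b) / d x_i) S_(b,i),
    which is [jacobian_contract].  Since r^(j+1) P = r (r^j P), the product rule
    ([modular_field_mulmx]) gives
      D(r^(j+1) P) = v(r^j P) + r D(r^j P).
    Everything follows once v(r^m P) = r^m v(P) for all m: as v(P) = D(r P),
    each step of the recursion then adds one more copy of r^j D(r P), and
    induction gives D(r^(j+1) P) = (j+1) r^j D(r P)
    ([modular_field_hierarchy]).

    The commutation of v with powers of r comes from the vanishing of the
    Nijenhuis torsion of r.  Contracting the torsion with S, and using that S
    and r S are skew-symmetric, leaves exactly v(r S) = r v(S); and all the
    r^m P are skew-symmetric because P and r P are ([trmx_mulXmx]).

    For the Toda lattice r is half of the block matrix (B, -A; C, B), and its
    only non-constant entries are the p_k and the exponentials in C.  The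
    contracted torsion identity ([toda_torsion_free]) then comes down to one
    relation between the signs A and the nearest neighbour interaction C:
      |C_(l,m)| (A_(l,k) - A_(m,k)) = C_(l,m) (delta_(k,l) + delta_(k,m)),
    namely [edge_A_mx]: when l and m are consecutive, the rows l and m of A
    differ only in the columns l and m. *)

(** * Directional derivatives *)

Section Derivatives.
Context {R : realType} {V : normedModType R}.

(** The exponential is differentiated in one variable, along the restriction
    of [f] to the line through [x] with direction [v]. *)
Lemma is_derive_expR_comp (f : V -> R) (x v : V) (df : R) :
  is_derive x v f df -> is_derive x v (expR \o f) (expR (f x) * df).
Proof.
move=> [fd fE].
pose g (h : R) := f (h *: v + x).
have gd : derivable g 0 1 by apply: (derivable1P f x v).1.
have g0 : g 0 = f x by rewrite /g scale0r add0r.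
have alongE (F : V -> R) : 'D_v F x = derive1 (fun h => F (h *: v + x)) 0.
  rewrite /derive /derive1.
  set d := (fun _ : R => _); set d' := (fun _ : R => _).
  suff -> : d = d' by [].
  by apply/funext => h; rewrite /d /d' /= addr0 scale0r add0r.
split.
  apply/(derivable1P (expR \o f) x v)/derivable1_diffP.
  by apply: (@differentiable_comp _ _ _ _ g expR); apply/derivable1_diffP.
rewrite alongE (derive1_comp gd) // -/g g0 -fE (alongE f) derive1E.
by congr (_ * _); apply: derive_val.
Qed.

Lemma derivable_mulmx (m n p : nat) (M : V -> 'M[R]_(m, n))
    (K : V -> 'M[R]_(n, p)) (x v : V) :
  (forall a b, derivable (fun y => M y a b) x v) ->
  (forall a b, derivable (fun y => K y a b) x v) ->
  forall a b, derivable (fun y => (M y *m K y) a b) x v.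
Proof.
move=> dM dK a b.
have -> : (fun y => (M y *m K y) a b) =
    \sum_(s < n) ((fun y => M y a s) * (fun y => K y s b)).
  by apply/funext => y; rewrite mxE fct_sumE.
by apply: derivable_sum => s; apply: derivableM.
Qed.

Lemma derive_mulmx (m n p : nat) (M : V -> 'M[R]_(m, n))
    (K : V -> 'M[R]_(n, p)) (x v : V) a b :
  (forall a b, derivable (fun y => M y a b) x v) ->
  (forall a b, derivable (fun y => K y a b) x v) ->
  'D_v (fun y => (M y *m K y) a b) x =
    \sum_s ('D_v (fun y => M y a s) x * K x s b +
            M x a s * 'D_v (fun y => K y s b) x).
Proof.
move=> dM dK.
have -> : (fun y => (M y *m K y) a b) =
    \sum_(s < n) ((fun y => M y a s) * (fun y => K y s b)).
  by apply/funext => y; rewrite mxE fct_sumE.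
rewrite derive_sum; last by move=> s; apply: derivableM.
by apply: eq_bigr => s _; rewrite deriveM // addrC mulrC.
Qed.

End Derivatives.

Lemma is_derive_coord {R : realType} {n : nat} (y v : 'rV[R]_n) i :
  is_derive y v (fun z : 'rV[R]_n => z 0 i) (v 0 i).
Proof.
have dI : derivable (@id 'rV[R]_n) y v by exact: derivable_id.
split; first by have /derivable_mxP := dI; apply.
have := derive_mx dI; rewrite derive_id => /matrixP/(_ 0 i).
by rewrite mxE.
Qed.

(** * Modular fields of the hierarchy generated by a recursion operator *)

Section Hierarchy.
Context {R : realType} {n : nat}.
Implicit Types (S P : 'M[R]_n) (dM : 'I_n -> 'M[R]_n).

(** With [dM i] the derivative of a matrix field M along the i-th coordinate,
    this is the part of the divergence of M S that comes from differentiating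
    M alone. *)
Definition jacobian_contract dM S : 'cV[R]_n :=
  \col_k \sum_i \sum_b dM i k b * S b i.

Definition partial_mx (M : 'rV[R]_n -> 'M[R]_n) (x : 'rV[R]_n) (i : 'I_n) :
    'M[R]_n :=
  \matrix_(a, b) partial i (fun y => M y a b) x.

Lemma modular_field_mulmx (M K : 'rV[R]_n -> 'M[R]_n) (x : 'rV[R]_n) :
  (forall i a b, derivable (fun y => M y a b) x (delta_mx 0 i)) ->
  (forall i a b, derivable (fun y => K y a b) x (delta_mx 0 i)) ->
  modular_field (fun y => M y *m K y) x =
    jacobian_contract (partial_mx M x) (K x) + M x *m modular_field K x.
Proof.
move=> dM dK; apply/colP => k; rewrite !mxE.
under [X in _ = _ + X]eq_bigr do rewrite mxE big_distrr /=.
rewrite [X in _ = _ + X]exchange_big -big_split /=; apply: eq_bigr => i _.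
rewrite /partial derive_mulmx // big_split /=; congr (_ + _).
by apply: eq_bigr => b _; rewrite mxE.
Qed.

Lemma modular_field_cst P (x : 'rV[R]_n) : modular_field (fun=> P) x = 0.
Proof.
apply/colP => k; rewrite !mxE big1 // => i _.
exact: derive_cst.
Qed.

(** [P] and [r *m P] being skew, [P *m r^T = r *m P]: powers of [r] can be moved
    across [P]. *)
Lemma trmx_mulXmx (r P : 'M[R]_n) m :
  P^T = - P -> (r *m P)^T = - (r *m P) -> (r ^+ m *m P)^T = - (r ^+ m *m P).
Proof.
move=> skP skrP.
have rPC : P *m r^T = r *m P.
  by apply: oppr_inj; rewrite -mulNmx -skP -trmx_mul.
suff rXPC : P *m (r ^+ m)^T = r ^+ m *m P by rewrite trmx_mul skP mulNmx rXPC.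
elim: m => [|m IH]; first by rewrite expr0 trmx1 mulmx1 mul1mx.
by rewrite [in LHS]exprS exprSr -!mulmxE trmx_mul mulmxA IH -!mulmxA rPC.
Qed.

(** The last hypothesis is the contraction with the bivector [S] of the vanishing
    Nijenhuis torsion of [r]; it makes [r] commute with the contraction [v], so
    that unfolding [r ^+ j.+1 *m P] one factor at a time contributes
    [r ^+ j *m v P] every time. *)
Lemma modular_field_hierarchy (r : 'rV[R]_n -> 'M[R]_n) P (x : 'rV[R]_n) j :
  (forall i a b, derivable (fun y => r y a b) x (delta_mx 0 i)) ->
  P^T = - P -> (r x *m P)^T = - (r x *m P) ->
  (forall S, S^T = - S -> (r x *m S)^T = - (r x *m S) ->
     jacobian_contract (partial_mx r x) (r x *m S) =
     r x *m jacobian_contract (partial_mx r x) S) ->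
  modular_field (fun y => r y ^+ j.+1 *m P) x =
    j.+1%:R *: (r x ^+ j *m modular_field (fun y => r y *m P) x).
Proof.
move=> dr skP skrP torsion0.
set v := jacobian_contract (partial_mx r x).
have skX m : (r x ^+ m *m P)^T = - (r x ^+ m *m P) by apply: trmx_mulXmx.
have vX m : v (r x ^+ m *m P) = r x ^+ m *m v P.
  elim: m => [|m IH]; first by rewrite expr0 !mul1mx.
  rewrite exprS -!mulmxE -!mulmxA /v torsion0 -/v ?IH //.
  by have := skX m.+1; rewrite exprS -mulmxE -mulmxA.
have dX m i a b :
    derivable (fun y => (r y ^+ m *m P) a b) x (delta_mx 0 i).
  elim: m a b => [|m IH] a b.
    under eq_fun do rewrite expr0 mul1mx; exact: derivable_cst.
  under eq_fun do rewrite exprS -mulmxE -mulmxA.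
  exact: derivable_mulmx.
have modX m : modular_field (fun y => r y ^+ m.+1 *m P) x =
    r x ^+ m *m v P + r x *m modular_field (fun y => r y ^+ m *m P) x.
  rewrite -vX -modular_field_mulmx //; congr (modular_field _ x).
  by apply/funext => y; rewrite mulmxA exprS mulmxE.
have -> : modular_field (fun y => r y *m P) x = v P.
  have := modX 0%N; rewrite expr0 mul1mx.
  under [X in modular_field X]eq_fun do rewrite expr1.
  move=> ->; under [X in modular_field X]eq_fun do rewrite expr0 mul1mx.
  by rewrite modular_field_cst mulmx0 addr0.
elim: j => [|j IH].
  rewrite modX; under [X in modular_field X]eq_fun do rewrite expr0 mul1mx.
  by rewrite modular_field_cst mulmx0 addr0 scale1r.
rewrite modX IH -scalemxAr mulmxA mulmxE -exprS.
by rewrite -[in RHS]natr1 scalerDl scale1r addrC.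
Qed.

End Hierarchy.

(** * Auxiliary facts on matrices and sums *)

Lemma skew_diag {R : realType} {n : nat} {K : 'M[R]_n} k :
  K^T = - K -> K k k = 0.
Proof.
move=> /matrixP/(_ k k); rewrite !mxE => /eqP.
by rewrite -addr_eq0 -mulr2n mulrn_eq0 => /eqP.
Qed.

Lemma skew_entry {R : realType} {n : nat} {K : 'M[R]_n} k l :
  K^T = - K -> K k l = - K l k.
Proof. by move=> /matrixP/(_ l k); rewrite !mxE. Qed.

Lemma sum_delta {R : realType} {n : nat} (F : 'I_n -> R) k :
  \sum_l (l == k)%:R * F l = F k.
Proof.
rewrite (bigD1 k) //= eqxx mul1r big1 ?addr0 // => l /negbTE->.
by rewrite mul0r.
Qed.

(** * The recursion operator of the Toda lattice and its torsion *)

Section TodaRecursion.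
Context {R : realType} {N : nat}.
Implicit Types x : 'rV[R]_(N + N).

(** The interaction [expR (q k - q l)] of neighbours, ordered so that the larger
    index is subtracted, as a symmetric matrix.  It also governs the derivative
    of C: along q_i, the (k, l) entry of C has derivative
    [((i == k) - (i == l)) * edge k l]. *)
Definition edge x (k l : 'I_N) : R := `|C_mx x k l|.

Lemma edgeE x k l :
  edge x k l = if l == k.+1 :> nat then C_mx x k l else - C_mx x k l.
Proof.
rewrite /edge mxE; case: ifP => [_|_]; first by rewrite ger0_norm ?expR_ge0.
by case: ifP => _; rewrite ?oppr0 ?opprK ?normr0 // normrN ger0_norm ?expR_ge0.
Qed.

Lemma C_mx_skew x k l : C_mx x l k = - C_mx x k l.
Proof.
rewrite !mxE; case: eqP => [e1|_]; case: eqP => [e2|_]; rewrite ?oppr0 ?opprK //.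
by exfalso; move: e1 e2; lia.
Qed.

Lemma edge_sym x k l : edge x l k = edge x k l.
Proof. by rewrite /edge C_mx_skew normrN. Qed.

(** Two consecutive rows of signs agree except where the column index meets one
    of the two row indices. *)
Lemma A_mx_step (l m k : 'I_N) : m = l.+1 :> nat ->
  A_mx R N l k - A_mx R N m k = (k == l)%:R + (k == m)%:R.
Proof.
rewrite !mxE -!val_eqE /= => ->.
have [lk|kl|<-] := ltngtP l k.
- have [lk'|kl'|_] := ltngtP l.+1 k; [by rewrite subrr addr0|lia|].
  by rewrite subr0 add0r.
- have -> : (k == l.+1 :> nat) = false by lia.
  have -> : (l.+1 < k)%N = false by lia.
  have -> : (k < l.+1)%N by lia.
  by rewrite subrr addr0.
- have -> : (l.+1 < l)%N = false by lia.
  have -> : (l == l.+1 :> nat) = false by lia.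
  by rewrite ltnSn sub0r opprK addr0.
Qed.

Lemma A_mx_skew : (A_mx R N)^T = - A_mx R N.
Proof.
by apply/matrixP => k l; rewrite !mxE; case: ltngtP; rewrite ?opprK ?oppr0.
Qed.

(** The factor [edge] vanishes unless [l] and [m] are consecutive, and its sign
    against [C_mx] says which of the two comes first. *)
Lemma edge_A_mx x (k l m : 'I_N) :
  edge x l m * (A_mx R N l k - A_mx R N m k) =
  C_mx x l m * ((k == l)%:R + (k == m)%:R).
Proof.
rewrite edgeE; case: eqP => [/A_mx_step-> //|ml].
case: (eqVneq (l : nat) m.+1) => [/A_mx_step E|lm].
  by rewrite -opprB E mulrNN addrC.
by rewrite mxE (introF eqP ml) (negbTE lm) oppr0 !mul0r.
Qed.

Lemma recursion_opE x :
  recursion_op x =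
  2^-1 *: block_mx (B_mx x) (- A_mx R N) (C_mx x) (B_mx x).
Proof.
have J1K : J1 x *m (- (4^-1 : R) *: J1hat R N) = 1%:M.
  rewrite /J1 -scalemxAl -scalemxAr scalerA mulrN mulfV ?pnatr_eq0 // scaleN1r.
  rewrite mulmx_block !(mul0mx, mulmx0, mul1mx, mulmx1, add0r, addr0).
  by rewrite opp_block_mx !oppr0 opprK -scalar_mx_block.
rewrite -[LHS]mulmx1 -J1K mulmxA mulmxKV ?J1_unit //.
rewrite /J2 -scalemxAl -scalemxAr scalerA mulmx_block.
rewrite !(mul0mx, mulmx0, mul1mx, mulmx1, add0r, addr0, mulmxN).
rewrite (_ : 2 * - 4^-1 = - 2^-1 :> R); last by field.
by rewrite scaleNr -scalerN opp_block_mx !opprK.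
Qed.

Definition dB_mx (i : 'I_(N + N)) : 'M[R]_N :=
  \matrix_(k, l) - ((l == k)%:R * (i == rshift N k)%:R).

Definition dC_mx x (i : 'I_(N + N)) : 'M[R]_N :=
  \matrix_(k, l)
    (((i == lshift N k)%:R - (i == lshift N l)%:R) * edge x k l).

Lemma is_derive_B_mx x i k l :
  is_derive x (delta_mx 0 i) (fun y => B_mx y k l) (dB_mx i k l).
Proof.
rewrite mxE; have [->|lk] := eqVneq l k; last first.
  rewrite mul0r oppr0 (_ : (fun y => _) = cst 0); first exact: is_derive_cst.
  by apply/funext => y; rewrite !mxE eq_sym (negbTE lk).
rewrite mul1r (_ : (fun y => _) =
    - (fun y : 'rV[R]_(N + N) => y 0 (rshift N k))); last first.
  by apply/funext => y; rewrite !mxE eqxx.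
apply: is_deriveN; have := is_derive_coord x (delta_mx 0 i) (rshift N k).
by rewrite mxE eqxx /= eq_sym.
Qed.

Lemma is_derive_expR_subq x i (k l : 'I_N) :
  is_derive x (delta_mx 0 i) (fun y => expR (q y k - q y l))
    (expR (q x k - q x l) * ((i == lshift N k)%:R - (i == lshift N l)%:R)).
Proof.
apply: (@is_derive_expR_comp _ _ (fun y => q y k - q y l)).
have dq j : is_derive x (delta_mx 0 i) (fun y => q y j) (i == lshift N j)%:R.
  have := is_derive_coord x (delta_mx 0 i) (lshift N j).
  by rewrite mxE eqxx /= eq_sym.
exact: is_deriveB.
Qed.

Lemma is_derive_C_mx x i k l :
  is_derive x (delta_mx 0 i) (fun y => C_mx y k l) (dC_mx x i k l).
Proof.
rewrite mxE edgeE mxE; have [lk|lk] := eqVneq (l : nat) k.+1.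
  rewrite mulrC (_ : (fun y => _) = fun y => expR (q y k - q y l)).
    exact: is_derive_expR_subq.
  by apply/funext => y; rewrite mxE lk eqxx.
have [kl|kl] := eqVneq (k : nat) l.+1; last first.
  rewrite oppr0 mulr0 (_ : (fun y => _) = cst 0); first exact: is_derive_cst.
  by apply/funext => y; rewrite !mxE (negbTE lk) (negbTE kl).
rewrite (_ : (fun y => _) = - (fun y => expR (q y l - q y k))); last first.
  by apply/funext => y; rewrite mxE (negbTE lk) kl eqxx.
rewrite -[_ * _]opprK -mulNr opprB opprK mulrC.
by apply: is_deriveN; apply: is_derive_expR_subq.
Qed.

Lemma is_derive_recursion_op x i a b :
  is_derive x (delta_mx 0 i) (fun y => recursion_op y a b)
    ((2^-1 *: block_mx (dB_mx i) 0 (dC_mx x i) (dB_mx i)) a b).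
Proof.
under eq_fun do rewrite recursion_opE mxE.
rewrite mxE; apply: (is_deriveZ (_ : R)).
case: (split_ordP a) => k ->; case: (split_ordP b) => l ->.
- rewrite block_mxEul; under eq_fun do rewrite block_mxEul.
  exact: is_derive_B_mx.
- rewrite block_mxEur mxE; under eq_fun do rewrite block_mxEur.
  exact: is_derive_cst.
- rewrite block_mxEdl; under eq_fun do rewrite block_mxEdl.
  exact: is_derive_C_mx.
- rewrite block_mxEdr; under eq_fun do rewrite block_mxEdr.
  exact: is_derive_B_mx.
Qed.

Lemma partial_recursion_op x i :
  partial_mx (@recursion_op R N) x i =
  2^-1 *: block_mx (dB_mx i) 0 (dC_mx x i) (dB_mx i).
Proof.
apply/matrixP => a b; rewrite mxE.
by have [_ <-] := is_derive_recursion_op x i a b.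
Qed.

Lemma sum_dB_mx k (F : 'I_N -> 'I_(N + N) -> R) :
  \sum_l \sum_i dB_mx i k l * F l i = - F k (rshift N k).
Proof.
rewrite -(sum_delta (F k)).
rewrite -(sum_delta (fun l => \sum_i (i == rshift N k)%:R * F l i)).
rewrite -sumrN; apply: eq_bigr => l _; rewrite big_distrr -sumrN.
by apply: eq_bigr => i _; rewrite mxE mulNr /= mulrA.
Qed.

Lemma sum_dC_mx x k (F : 'I_N -> 'I_(N + N) -> R) :
  \sum_l \sum_i dC_mx x i k l * F l i =
  \sum_l edge x k l * (F l (lshift N k) - F l (lshift N l)).
Proof.
apply: eq_bigr => l _.
rewrite -(sum_delta (F l)) -[F l (lshift N l)](sum_delta (F l)).
rewrite -sumrB big_distrr; apply: eq_bigr => i _ /=.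
by rewrite mxE; ring.
Qed.

(** Only the diagonal entries of the B blocks (each depending on one p) and the
    entries of C (each depending on two q's) contribute, so that the result sees
    [K], [U] and [M] only at equal or neighbouring sites. *)
Lemma contract_recursion_op x (K U L M : 'M[R]_N) :
  jacobian_contract (partial_mx (@recursion_op R N) x) (block_mx K U L M) =
  2^-1 *: col_mx (\col_k - U k k)
    (\col_k (\sum_l edge x k l * (K l k - K l l) - M k k)).
Proof.
apply/colP => a; rewrite mxE [RHS]mxE.
under eq_bigr do under eq_bigr do rewrite partial_recursion_op mxE -mulrA.
under eq_bigr do rewrite -big_distrr /=.
rewrite -big_distrr exchange_big big_split_ord /=; congr (_ * _).
case: (split_ordP a) => k ->.
  under eq_bigr do under eq_bigr do rewrite block_mxEul.
  under [X in _ + X]eq_bigr do under eq_bigr do rewrite block_mxEur mxE mul0r.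
  under [X in _ + X]eq_bigr do rewrite sumr_const mul0rn.
  rewrite sumr_const mul0rn addr0.
  by rewrite (sum_dB_mx k (fun l => block_mx K U L M (lshift N l)))
    block_mxEur col_mxEu mxE.
under eq_bigr do under eq_bigr do rewrite block_mxEdl.
under [X in _ + X]eq_bigr do under eq_bigr do rewrite block_mxEdr.
rewrite (sum_dC_mx x k (fun l => block_mx K U L M (lshift N l))).
rewrite (sum_dB_mx k (fun l => block_mx K U L M (rshift N l))).
rewrite block_mxEdr col_mxEd mxE; congr (_ - _).
by apply: eq_bigr => l _; rewrite !block_mxEul.
Qed.

(** Twice the left-hand side is obtained by antisymmetrizing in [l] and [m], since
    [K] is skew and [edge] symmetric; [edge_A_mx] then collapses the double sum. *)
Lemma A_mx_mul_edge x (K : 'M[R]_N) k : K^T = - K ->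
  \sum_l A_mx R N k l * (\sum_m edge x l m * K l m) =
  \sum_l C_mx x k l * K l k.
Proof.
move=> skK; set s := LHS.
have s1 : s = - \sum_l \sum_m (edge x l m * K l m) * A_mx R N l k.
  rewrite /s -sumrN; apply: eq_bigr => l _; rewrite -sumrN big_distrr.
  apply: eq_bigr => m _ /=; rewrite (skew_entry l k A_mx_skew).
  by rewrite mulrN opprK mulrC.
have s2 : s = \sum_l \sum_m (edge x l m * K l m) * A_mx R N m k.
  rewrite s1 exchange_big -sumrN; apply: eq_bigr => l _.
  rewrite -sumrN; apply: eq_bigr => m _.
  by rewrite edge_sym (skew_entry m l skK) mulrN mulNr opprK.
have ss : s + s =
    - \sum_l \sum_m C_mx x l m * K l m * ((k == l)%:R + (k == m)%:R).
  rewrite {1}s1 {1}s2 -sumrN -big_split -sumrN /=; apply: eq_bigr => l _.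
  rewrite -sumrN -big_split -sumrN /=; apply: eq_bigr => m _.
  by rewrite [C_mx x l m * _ * _]mulrAC -edge_A_mx; ring.
pose F l m := C_mx x l m * K l m.
have F_sym l m : F l m = F m l.
  by rewrite /F C_mx_skew (skew_entry l m skK) mulrNN.
have FE : \sum_l \sum_m F l m * ((k == l)%:R + (k == m)%:R) =
    \sum_m F k m + \sum_l F l k.
  rewrite -(sum_delta (fun l => \sum_m F l m)) -big_split /=.
  apply: eq_bigr => l _; rewrite -(sum_delta (F l)) big_distrr -big_split /=.
  by apply: eq_bigr => m _; rewrite (eq_sym k l) (eq_sym k m); ring.
have t1 : \sum_m F k m = - \sum_l C_mx x k l * K l k.
  rewrite -sumrN; apply: eq_bigr => m _.
  by rewrite /F (skew_entry k m skK) mulrN.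
have t2 : \sum_l F l k = \sum_m F k m by apply: eq_bigr => m _; rewrite F_sym.
have : s + s = - (\sum_m F k m + \sum_l F l k) by rewrite -FE.
by rewrite t2 t1; lra.
Qed.

Lemma edge_sum_A_mx_mul x (L : 'M[R]_N) k :
  \sum_l edge x k l * ((A_mx R N *m L) k l - (A_mx R N *m L) l l) =
  \sum_l C_mx x k l * (L k l + L l l).
Proof.
apply: eq_bigr => l _; rewrite [(_ *m L) k l]mxE [(_ *m L) l l]mxE.
rewrite -sumrB big_distrr /=.
under eq_bigr do rewrite -mulrBl mulrA edge_A_mx -mulrA mulrDl.
by rewrite -big_distrr big_split /= !(sum_delta (fun m => L m l)).
Qed.

Lemma skew_block (K U L M : 'M[R]_N) :
  (block_mx K U L M)^T = - block_mx K U L M ->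
  [/\ K^T = - K, L^T = - U & M^T = - M].
Proof.
by rewrite tr_block_mx opp_block_mx => /eq_block_mx [? ? ? ?].
Qed.

(** For a skew bivector the diagonal entries [M k k] and [K l l] vanish.  They are
    kept, with the signs that make the transposed formula, because for a product
    [recursion_op x *m S] the differences [K k l - K l l] are what
    [edge_sum_A_mx_mul] evaluates: the torsion identity then needs no further
    use of the skewness of the product. *)
Lemma contract_recursion_op_skew x (K U L M : 'M[R]_N) :
  (block_mx K U L M)^T = - block_mx K U L M ->
  jacobian_contract (partial_mx (@recursion_op R N) x) (block_mx K U L M) =
  2^-1 *: col_mx (\col_k L k k)
    (\col_k (M k k - \sum_l edge x k l * (K k l - K l l))).
Proof.
move=> /skew_block[skK LU skM]; rewrite contract_recursion_op.
congr (_ *: col_mx _ _); apply/colP => k; rewrite !mxE.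
  by move/matrixP/(_ k k): LU; rewrite !mxE => ->.
rewrite (skew_diag k skM) subr0 sub0r -sumrN; apply: eq_bigr => l _.
by rewrite (skew_diag l skK) !subr0 (skew_entry l k skK) mulrN.
Qed.

Lemma mul_B_mxE {n} x (K : 'M[R]_(N, n)) k l :
  (B_mx x *m K) k l = - p x k * K k l.
Proof. by rewrite mul_diag_mx !mxE. Qed.

(** Let K, U, L, M be the blocks of [S].  In the q components the identity
    reduces to [A_mx_mul_edge]; in the p components, to [edge_sum_A_mx_mul] and
    the cancellation of the terms in L k l against the diagonal of [C_mx x]
    times U, as U is minus the transpose of L. *)
Lemma toda_torsion_free x (S : 'M[R]_(N + N)) :
  S^T = - S -> (recursion_op x *m S)^T = - (recursion_op x *m S) ->
  jacobian_contract (partial_mx (@recursion_op R N) x) (recursion_op x *m S) =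
  recursion_op x *m jacobian_contract (partial_mx (@recursion_op R N) x) S.
Proof.
rewrite recursion_opE -(submxK S).
move: (ulsubmx S) (ursubmx S) (dlsubmx S) (drsubmx S) => K U L M skS.
have [skK LU skM] := skew_block _ _ _ _ skS.
rewrite -scalemxAl mulmx_block scale_block_mx => skRS.
rewrite (contract_recursion_op_skew _ _ _ _ _ skRS).
have -> : jacobian_contract (partial_mx (@recursion_op R N) x)
      (block_mx K U L M) =
    2^-1 *: col_mx (\col_k L k k) (- \col_k \sum_l edge x k l * K k l).
  rewrite contract_recursion_op_skew //.
  congr (_ *: col_mx _ _); apply/colP => k; rewrite !mxE (skew_diag k skM) sub0r.
  by congr (- _); apply: eq_bigr => l _; rewrite (skew_diag l skK) subr0.
rewrite -scalemxAr -[in RHS]scalemxAl; congr (_ *: _).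
rewrite mul_block_col scale_col_mx mulmxN !mulNmx opprK.
congr col_mx; apply/colP => k.
  rewrite mxE mxE [RHS]mxE; congr (_ * _).
  rewrite mxE mul_B_mxE addrC [RHS]mxE mul_B_mxE mxE; congr (_ + _).
  rewrite [LHS]mxE [RHS]mxE -(A_mx_mul_edge x K k skK).
  by apply: eq_bigr => l _; rewrite [X in _ = _ * X]mxE.
have XE i j : (2^-1 *: (B_mx x *m K - A_mx R N *m L)) i j =
    2^-1 * (- p x i * K i j - (A_mx R N *m L) i j).
  rewrite mxE [X in _ * X]mxE mul_B_mxE.
  by congr (_ * (_ + _)); rewrite mxE.
rewrite [RHS]mxE [X in _ = _ * X]mxE mulmxN [X in _ = _ * (_ + X)]mxE mul_B_mxE.
rewrite [LHS]mxE.
have -> : \sum_l edge x k l *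
      ((2^-1 *: (B_mx x *m K - A_mx R N *m L)) k l -
       (2^-1 *: (B_mx x *m K - A_mx R N *m L)) l l) =
    2^-1 * (- p x k * (\sum_l edge x k l * K k l) -
            \sum_l C_mx x k l * (L k l + L l l)).
  rewrite -edge_sum_A_mx_mul [- p x k * _]big_distrr -sumrB [RHS]big_distrr /=.
  apply: eq_bigr => l _.
  by rewrite !XE (skew_diag l skK); ring.
rewrite mxE [X in _ * X]mxE mul_B_mxE (skew_diag k skM) mulr0 addr0.
have -> : (C_mx x *m U) k k = - \sum_l C_mx x k l * L k l.
  rewrite mxE -sumrN; apply: eq_bigr => l _.
  by rewrite -[U]opprK -LU !mxE mulrN.
have -> : (C_mx x *m \col_l L l l) k 0 = \sum_l C_mx x k l * L l l.
  by rewrite mxE; apply: eq_bigr => l _; rewrite [X in _ * X]mxE.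
under [X in _ - _ * (_ - X)]eq_bigr do rewrite mulrDr.
by rewrite big_split /= [(\col__ _) k 0]mxE; ring.
Qed.

Lemma J1_skew x : (J1 x)^T = - J1 x.
Proof.
rewrite /J1 linearZ /= -scalerN; congr (_ *: _).
by rewrite tr_block_mx opp_block_mx !trmx0 linearN /= trmx1 !oppr0 opprK.
Qed.

Lemma J2_skew x : (J2 x)^T = - J2 x.
Proof.
rewrite /J2 linearZ /= -scalerN; congr (_ *: _).
rewrite tr_block_mx opp_block_mx A_mx_skew linearN /= tr_diag_mx opprK.
congr block_mx; apply/matrixP => k l.
by rewrite mxE C_mx_skew [RHS]mxE.
Qed.

End TodaRecursion.

Theorem theorem6 (R : realType) (N : nat) (hN : (2 <= N)%N)
    (j : nat) (hj : (2 <= j)%N) (x : 'rV[R]_(N + N)) :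
  toda_modular j.+1 x =
  j%:R *: (recursion_op x ^+ j.-1 *m toda_modular 2 x).
Proof.
case: j hj => [//|j _].
have recJ1 : recursion_op x *m J1 x = J2 x by rewrite mulmxKV ?J1_unit.
have modE m : toda_modular m.+1 x =
    modular_field (fun y => recursion_op y ^+ m *m J1 x) x by [].
rewrite !modE; under [X in _ *: (_ *m modular_field X x)]eq_fun do rewrite expr1.
apply: modular_field_hierarchy.
- by move=> i a b; have [] := is_derive_recursion_op x i a b.
- exact: J1_skew.
- by rewrite recJ1 J2_skew.
- exact: toda_torsion_free.
Qed.
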